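(* For every fixed integer $d\ge3$ and every real $\gamma>0$, there is a constant $c_{d,\gamma}>0$, depending only on $d$ and $\gamma$, such that there are arbitrarily large integers $p$ with $$\mathrm{HD}_d(p,d+1)\ge c_{d,\gamma}\,p^{2-\gamma}.$$ Equivalently, for every fixed $d\ge3$, $\mathrm{HD}_d(p,d+1)\ge p^{2-o(1)}$ along an unbounded sequence of values of $p$.
   Context: For positive integers $p\ge q$, a family $\mathcal F$ of (distinct) sets with at least $p$ members satisfies the $(p,q)$-property if among every $p$ members of $\mathcal F$ some $q$ have a nonempty common intersection. A transversal (piercing set) of $\mathcal F$ is a set of points meeting every member of $\mathcal F$, and $\tau(\mathcal F)$ is the minimum size of a transversal. For $p\ge q\ge d+1$, the Hadwiger–Debrunner number $\mathrm{HD}_d(p,q)$ is the least integer $N$ such that $\tau(\mathcal F)\le N$ for every finite family $\mathcal F$ of nonempty compact convex sets in $\mathbb{R}^d$ satisfying the $(p,q)$-property (for finite families compactness is inessential). *)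

(* Defs.v *)
From HB Require Import structures.
From mathcomp Require Import all_boot all_order all_algebra finmap.
From mathcomp Require Import all_classical all_reals all_analysis.

Set Implicit Arguments.
Unset Strict Implicit.
Unset Printing Implicit Defensive.

Import Order.TTheory GRing.Theory Num.Theory.
Import numFieldNormedType.Exports.

Local Open Scope classical_set_scope.
Local Open Scope ring_scope.

(* Least element of a set of natural numbers, as an extended real; it is +oo
   exactly when the set is empty. *)
Definition least (R : realType) (A : set nat) : \bar R :=
  ereal_inf [set n%:R%:E | n in A].

Section HadwigerDebrunner.
Variables (R : realType) (d : nat).
Implicit Types F G H : {fset set 'rV[R]_d}.

Definition pq_property (p q : nat) F : Prop :=
  (p <= #|` F|)%N /\
  forall G, (G `<=` F)%fset -> #|` G| = p ->
    exists H, [/\ (H `<=` G)%fset, #|` H| = q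
                & exists x : 'rV[R]_d, forall A, A \in H -> A x].

Definition transversal F (X : {fset 'rV[R]_d}) : Prop :=
  forall A, A \in F -> exists2 x, x \in X & A x.

Definition tau F : \bar R :=
  least R [set k | exists2 X, transversal F X & #|` X| = k].

Definition nonempty_compact_convex (A : set 'rV[R]_d) : Prop :=
  [/\ A !=set0, compact A & convex_set A].

(* Meaningful for d.+1 <= q <= p, when the set below is nonempty by the
   Alon-Kleitman theorem, so that HD is the value of a natural number. *)
Definition HD (p q : nat) : \bar R :=
  least R [set N | forall F, (forall A, A \in F -> nonempty_compact_convex A) ->
                     pq_property p q F -> (tau F <= N%:R%:E)%E].

End HadwigerDebrunner.

(* Main.v *)
(** Lift each point x of the grid [k]^m to v_x = (1, x) and assign to it the
    hyperplane {y | y M v_x = b v_x} of R^d, where the d x (m+1) matrix M and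
    the row b are generic. By genericity, grid points whose lifts span a space
    of dimension at most d have hyperplanes with a common point, and conversely.
    A space of dimension d contains at most k^d lifts, so no point pierces more
    than k^d of the k^m hyperplanes, and any transversal has at least k^(m-d)
    elements. On the other hand, once 'C(p, 2) > (2k-1)^m, any p grid points
    contain two distinct pairs with the same sum; since d >= 3, the union of
    these pairs extends to d+1 dependent points, hence to d+1 hyperplanes with a
    common point. Thus p is about (2k)^(m/2), and letting k grow makes the
    exponent of p in k^(m-d) tend to 2. Compactness is obtained by intersecting
    the hyperplanes with a large ball. *)
Require Import Defs.
From mathcomp Require Import all_boot all_order all_algebra finmap.
From mathcomp Require Import all_classical all_reals all_analysis.
From mathcomp Require Import zify lra.

Import Order.TTheory GRing.Theory Num.Theory.
Import numFieldNormedType.Exports.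

Local Open Scope classical_set_scope.
Local Open Scope ring_scope.

Set Implicit Arguments.
Unset Strict Implicit.
Unset Printing Implicit Defensive.

(** * Matrices generic for a finite family *)

Lemma exists_nonroot (F : numFieldType) (q : {poly F}) :
  q != 0 -> exists t, ~~ root q t.
Proof.
move=> q0; set rs : seq F := [seq i%:R | i <- iota 0 (size q)].
have [rsq|/allPn[t _ qt]] := boolP (all (root q) rs); last by exists t.
have rsU : uniq rs by rewrite map_inj_uniq ?iota_uniq// => i j /eqP; rewrite eqr_nat => /eqP.
by have := max_poly_roots q0 rsq rsU; rewrite size_map size_iota ltnn.
Qed.

(* A row of the form (1, t, t^2, ...) works, since multiplying by it evaluates
   at t the polynomials whose coefficients are the columns. *)
Lemma exists_row_avoiding_kernels (F : numFieldType) n (I : finType)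
    (c : I -> nat) (D : forall i, 'M[F]_(n, c i)) :
  exists b : 'rV[F]_n, forall i, D i != 0 -> b *m D i != 0.
Proof.
have [q qP] : exists q : I -> {poly F}, forall i, q i != 0 /\
    forall t, ~~ root (q i) t -> D i != 0 -> (\row_(l < n) t ^+ l) *m D i != 0.
  apply: (@fin_all_exists _ (fun=> {poly F}) (fun i q => q != 0 /\
    forall t, ~~ root q t -> D i != 0 -> (\row_(l < n) t ^+ l) *m D i != 0)) => i.
  have [->|D0] := eqVneq (D i) 0; first by exists 1; rewrite oner_eq0; split.
  have [j Dj] : exists j, (col j (D i))^T != 0.
    apply/existsP; apply: contraNT D0 => /existsPn Dj.
    apply/eqP/matrixP => l j; have /negPn/eqP/rowP/(_ l) := Dj j.
    by rewrite !mxE.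
  exists (rVpoly (col j (D i))^T); split => [|t].
    apply: contraNneq Dj => /(congr1 (poly_rV (d := n))).
    by rewrite rVpolyK linear0 => ->.
  move=> qt _; apply: contraNneq qt => /matrixP/(_ 0 j); rewrite !mxE => tD0.
  apply/eqP; rewrite (horner_coef_wide _ (size_poly _ _)) -[RHS]tD0.
  by apply: eq_bigr => l _; rewrite coef_rVpoly_ord !mxE mulrC.
have [|t qt] := @exists_nonroot _ (\prod_i q i).
  by apply/prodf_neq0 => i _; case: (qP i).
exists (\row_(l < n) t ^+ l) => i; apply: (qP i).2.
by apply: contraNN qt => qit; rewrite (bigD1 i)//= rootM qit.
Qed.

Definition rank_generic (F : fieldType) n r (I : finType) (c : I -> nat)
    (A : forall i, 'M[F]_(n, c i)) (M : 'M[F]_(r, n)) :=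
  forall i, \rank (M *m A i) = minn r (\rank (A i)).

(** If [A i] has rank at most [r], then [M *m A i] already has the full rank of [A i]. Otherwise the
    row space of [A i] is not contained in that of [M *m A i], so [A i *m cokermx (M *m A i)] is
    nonzero, and a row [b] not killed by it adds a dimension. *)
Lemma rank_generic_extend (F : numFieldType) n r (I : finType) (c : I -> nat)
    (A : forall i, 'M[F]_(n, c i)) (M : 'M[F]_(r, n)) :
  rank_generic A M -> exists b : 'rV[F]_n, rank_generic A (col_mx M b).
Proof.
move=> MA.
have [b bA] := exists_row_avoiding_kernels (fun i => A i *m cokermx (M *m A i)).
exists b => i; rewrite mul_col_mx; have := MA i.
have [Ar rMA|rA rMA] := leqP (\rank (A i)) r.
  rewrite (minn_idPr _); last by rewrite (leq_trans Ar) ?leq_addr.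
  apply/eqP; rewrite eqn_leq -mul_col_mx mxrankM_maxr mul_col_mx -{1}rMA.
  by apply: mxrankS; rewrite -addsmxE addsmxSl.
have MA_A : ~~ (A i <= M *m A i)%MS.
  by apply/negP => /mxrankS; rewrite rMA leqNgt rA.
rewrite (minn_idPl _); last by rewrite addn1.
apply/eqP; rewrite eqn_leq rank_leq_row /= [leqLHS]addn1 -{1}rMA.
apply: rank_ltmx.
rewrite ltmxE -{1}addsmxE addsmxSl col_mx_sub submx_refl /= submxE.
by rewrite -mulmxA bA// -submxE.
Qed.

Lemma exists_rank_generic (F : numFieldType) n r (I : finType) (c : I -> nat)
    (A : forall i, 'M[F]_(n, c i)) :
  exists M : 'M[F]_(r, n), rank_generic A M.
Proof.
elim: r => [|r [M MA]]; first by exists 0 => i; rewrite mul0mx mxrank0 min0n.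
by rewrite -addn1; have [b] := rank_generic_extend MA; exists (col_mx M b).
Qed.

(* Some r coordinates already determine all the vectors of the family. *)
Lemma card_le_expn_rank (F : fieldType) (K : finType) n c
    (phi : 'I_n -> K -> F) (g : 'I_n -> 'I_c -> K)
    (A := \matrix_(i, j) phi i (g i j)) :
  injective (fun j => col j A) -> (c <= #|K| ^ \rank A)%N.
Proof.
(* The \rank A rows selected by f already determine every column. *)
move=> Ainj; set f := maxrankfun A.
have [C AC] : exists C, A = C *m rowsub f A.
  by apply/submxP; rewrite eq_maxrowsub submx_refl.
rewrite -[X in (_ ^ X)%N]card_ord -card_ffun -[leqLHS]card_ord.
apply: (leq_card (fun j => [ffun i => g (f i) j])) => j1 j2 /ffunP g12.
apply: Ainj; apply/colP => l; rewrite AC !mxE; apply: eq_bigr => i _.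
by have := g12 i; rewrite !mxE !ffunE => ->.
Qed.

(** * Hyperplanes clipped to a ball *)

Definition clipped_hyperplane (R : realType) d (w : 'cV[R]_d) (a B : R) :
    set 'rV[R]_d :=
  [set y | (y *m w) 0 0 = a /\ `|y| <= B].

Lemma clipped_hyperplane_compact (R : realType) d (w : 'cV[R]_d) a B :
  compact (clipped_hyperplane w a B).
Proof.
apply: bounded_closed_compact.
  exists B; split=> [|x Bx y [_ yB]]; first exact: num_real.
  exact: le_trans yB (ltW Bx).
have cont_w : continuous (fun y : 'rV[R]_d => (y *m w) 0 0).
  have -> : (fun y : 'rV[R]_d => (y *m w) 0 0) =
            (fun y => \sum_(i < d) y 0 i * w i 0).
    by apply/funext => z; rewrite mxE.
  apply: (@continuous_big R _ +%R); first exact: add_continuous.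
  move=> i _ z; apply: (@cvgMr_tmp _ _ (nbhs z)).
  exact: (@coord_continuous R 1 d 0 i z).
apply: closedI.
- by apply: (@preimage_closed _ _ _ [set a]) => [y _|]; [exact: cont_w|exact: closed_eq].
- apply: (@preimage_closed _ R (fun y : 'rV[R]_d => `|y|) [set r | r <= B]).
    by move=> y _; exact: norm_continuous.
  exact: closed_le.
Qed.

Lemma clipped_hyperplane_convex (R : realType) d (w : 'cV[R]_d) a B :
  convex_set (clipped_hyperplane w a B).
Proof.
move=> x y t /set_mem[xw xB] /set_mem[yw yB]; apply/mem_set; split.
  rewrite /conv/= mulmxDl -!scalemxAl mxE [X in X + _]mxE [X in _ + X]mxE.
  by rewrite xw yw -mulrDl addrC subrK mul1r.
have t1 : 0 <= unstable.onem t%:num by rewrite subr_ge0 le1.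
rewrite (le_trans (ler_normD _ _))// !normrZ !ger0_norm ?ge0//.
rewrite (le_trans (lerD (ler_wpM2l _ xB) (ler_wpM2l _ yB)))//.
by rewrite -mulrDl addrC subrK mul1r.
Qed.

Definition columns (F : fieldType) n (V : finType) (v : V -> 'cV[F]_n)
    (T : {set V}) : 'M[F]_(n, #|T|) :=
  \matrix_(i, j) v (enum_val j) i 0.

Lemma col_columns (F : fieldType) n (V : finType) (v : V -> 'cV[F]_n)
    (T : {set V}) j : col j (columns v T) = v (enum_val j).
Proof. by apply/colP => i; rewrite !mxE. Qed.

Lemma mulmx_columns (F : fieldType) m n (V : finType) (v : V -> 'cV[F]_n)
    (T : {set V}) (w : 'M[F]_(m, n)) i j :
  (w *m columns v T) i j = (w *m v (enum_val j)) i 0.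
Proof. by rewrite !mxE; apply: eq_bigr => l _; rewrite !mxE. Qed.

(** A common point [y] of the hyperplanes of [T] solves [y *m M *m columns v T = b *m columns v T].
    At rank at most [d], [M] preserves the row space of [columns v T], so a solution exists. At
    larger rank, the d+1 rows of [col_mx M b *m columns v T] are independent, so none does. *)
Lemma exists_clipped_hyperplanes (R : realType) d n (V : finType)
    (v : V -> 'cV[R]_n) :
  (1 < d)%N ->
  (forall x y, x != y -> (1 < \rank (columns v [set x; y]))%N) ->
  exists C : V -> set 'rV[R]_d,
    [/\ injective C,
        forall x, nonempty_compact_convex (C x),
        forall T : {set V}, (\rank (columns v T) <= d)%N ->
          exists y, forall x, x \in T -> C x y
      & forall (T : {set V}) y, (forall x, x \in T -> C x y) ->
          (\rank (columns v T) <= d)%N].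
Proof.
move=> d1 v2; have [M MA] := exists_rank_generic d (columns v).
have [b bA] := rank_generic_extend MA.
pose H x (y : 'rV[R]_d) := (y *m M *m v x) 0 0 = (b *m v x) 0 0.
have sol (T : {set V}) (w : 'rV_#|T|) : (w <= M *m columns v T)%MS ->
    exists y : 'rV[R]_d, forall j, (y *m M *m v (enum_val j)) 0 0 = w 0 j.
  by move=> /submxP[y ->]; exists y => j; rewrite mulmxA mulmx_columns.
have [P HP] : exists P : {set V} -> 'rV[R]_d, forall T,
    (\rank (columns v T) <= d)%N -> forall x, x \in T -> H x (P T).
  apply: (@fin_all_exists _ (fun=> 'rV[R]_d) (fun T y =>
    (\rank (columns v T) <= d)%N -> forall x, x \in T -> H x y)) => T.
  have [Td|Td] := leqP (\rank (columns v T)) d; last by exists 0.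
  have MAA : (M *m columns v T == columns v T)%MS.
    by rewrite -(mxrank_leqif_eq (submxMl _ _)) MA (minn_idPr Td).
  have [|y Hy] := sol T (b *m columns v T).
    by rewrite (eqmxP MAA) submxMl.
  exists y => _ x xT; rewrite /H -(enum_rankK_in xT xT) Hy mulmx_columns.
  by [].
have [Z HZ] : exists Z : V * V -> 'rV[R]_d, forall p, p.1 != p.2 ->
    H p.1 (Z p) /\ ~ H p.2 (Z p).
  apply: (@fin_all_exists _ (fun=> 'rV[R]_d) (fun p z =>
    p.1 != p.2 -> H p.1 z /\ ~ H p.2 z)) => -[x y] /=.
  have [->|xy] := eqVneq x y; first by exists 0.
  have xT : x \in [set x; y]%SET by rewrite !inE eqxx.
  have yT : y \in [set x; y]%SET by rewrite !inE eqxx orbT.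
  (* [M *m columns v [set x; y]] has rank 2, so any two values can be prescribed: here the one that
     puts [z] on the hyperplane of [x], and the one for [y] shifted by 1. *)
  have [|z Hz] := @sol [set x; y]%SET
      (b *m columns v _ + delta_mx 0 (enum_rank_in yT y)).
    apply: submx_full; rewrite /row_full eqn_leq rank_leq_col /= MA.
    by rewrite [leqLHS]cards2 xy leq_min d1 v2.
  exists z => _; split; rewrite /H.
    rewrite -(enum_rankK_in xT xT) Hz mxE mulmx_columns [X in _ + X]mxE.
    rewrite (_ : (_ == enum_rank_in yT y) = false) ?andbF ?addr0//.
    apply: contraNF xy => /eqP/(congr1 enum_val).
    by rewrite !enum_rankK_in// => ->.
  rewrite -(enum_rankK_in yT yT) Hz mxE mulmx_columns [X in _ + X]mxE !eqxx.
  by move/eqP; rewrite -subr_eq0 addrAC subrr add0r oner_eq0.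
(* Only finitely many witnesses [P T] and [Z p] were chosen, so one radius keeps them all after
   clipping. *)
pose B := \sum_T `|P T| + \sum_p `|Z p|.
have PB T : `|P T| <= B.
  by rewrite /B (bigD1 T)//= -addrA lerDl; apply: addr_ge0; apply: sumr_ge0.
have ZB p : `|Z p| <= B.
  rewrite /B addrC (bigD1 p)//= -addrA lerDl.
  by apply: addr_ge0; apply: sumr_ge0.
exists (fun x => clipped_hyperplane (M *m v x) ((b *m v x) 0 0) B).
have HC x y : H x y -> `|y| <= B -> clipped_hyperplane (M *m v x) ((b *m v x) 0 0) B y.
  by move=> Hxy yB; split=> //; rewrite mulmxA.
have Hcap T : (\rank (columns v T) <= d)%N ->
    exists y, forall x, x \in T -> clipped_hyperplane (M *m v x) ((b *m v x) 0 0) B y.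
  by move=> Td; exists (P T) => x xT; apply: HC => //; apply: HP.
split=> [x y Cxy|x|//|T y Cy].
- apply: contrapT => /eqP xy; have [Hx nHy] := HZ (x, y) xy; apply: nHy.
  by have := HC _ _ Hx (ZB (x, y)); rewrite Cxy => -[]; rewrite mulmxA.
- split; [|exact: clipped_hyperplane_compact|exact: clipped_hyperplane_convex].
  have [|y Hy] := Hcap [set x]%SET; last by exists y; apply: Hy; rewrite inE.
  by rewrite (leq_trans (rank_leq_col _))// cards1 ltnW.
- rewrite leqNgt; apply/negP => dT.
  have yMb : y *m M *m columns v T = b *m columns v T.
    apply/rowP => j; rewrite !mulmx_columns -mulmxA.
    by have [] := Cy _ (enum_valP j).
  (* The nonzero row (y, -1) kills a matrix whose rows are independent, a contradiction. *)
  have k0 : row_mx y (-1%:M) *m (col_mx M b *m columns v T) = 0.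
    by rewrite mulmxA mul_row_col mulNmx mul1mx mulmxBl yMb subrr.
  have /row_freeP[D] : row_free (col_mx M b *m columns v T).
    by rewrite /row_free bA (minn_idPl _)// addn1.
  move/(congr1 (mulmx (row_mx y (-1%:M)))); rewrite mulmxA k0 mul0mx mulmx1.
  move/(congr1 rsubmx); rewrite row_mxKr linear0 => /rowP/(_ 0)/eqP.
  by rewrite !mxE eqxx eq_sym oppr_eq0 oner_eq0.
Qed.

(** * Linear relations among columns *)

Lemma mulmx_columns_col (F : fieldType) n (V : finType) (v : V -> 'cV[F]_n)
    (T : {set V}) (u : V -> F) :
  columns v T *m (\col_j u (enum_val j)) = \sum_(x in T) u x *: v x.
Proof.
rewrite big_enum_val; apply/colP => i; rewrite mxE summxE.
by apply: eq_bigr => j _; rewrite !mxE mulrC.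
Qed.

Lemma rank_columns_lt (F : fieldType) n (V : finType) (v : V -> 'cV[F]_n)
    (T : {set V}) (u : V -> F) :
  \sum_(x in T) u x *: v x = 0 -> (exists2 x, x \in T & u x != 0) ->
  (\rank (columns v T) < #|T|)%N.
Proof.
move=> uv0 [x xT]; apply: contraNT; rewrite -leqNgt => rT.
have : row_free (columns v T)^T.
  by rewrite /row_free mxrank_tr eqn_leq rank_leq_col.
move=> /row_freeP[D DE].
have : (\col_j u (enum_val j))^T *m ((columns v T)^T *m D) = 0.
  by rewrite mulmxA -trmx_mul mulmx_columns_col uv0 trmx0 mul0mx.
by rewrite DE mulmx1 => /rowP/(_ (enum_rank_in xT x)); rewrite !mxE enum_rankK_in// => ->.
Qed.

Lemma rank_columns_full (F : fieldType) n (V : finType) (v : V -> 'cV[F]_n)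
    (T : {set V}) :
  (forall u : V -> F, \sum_(x in T) u x *: v x = 0 -> {in T, u =1 fun=> 0}) ->
  \rank (columns v T) = #|T|.
Proof.
move=> vT; apply/eqP; rewrite -mxrank_tr; apply: inj_row_free => w wT.
pose u x := \sum_j w 0 j * (enum_val j == x)%:R.
have uE j : u (enum_val j) = w 0 j.
  rewrite /u (bigD1 j)//= eqxx mulr1 big1 ?addr0// => l lj.
  by rewrite (inj_eq enum_val_inj) (negbTE lj) mulr0.
apply/rowP => j; rewrite -uE mxE vT ?enum_valP// -mulmx_columns_col.
have -> : \col_l u (enum_val l) = w^T by apply/colP => l; rewrite !mxE uE.
by apply: trmx_inj; rewrite trmx_mul trmxK wT trmx0.
Qed.

Lemma exists_set_between (T : finType) (A B : {set T}) n :
  A \subset B -> (#|A| <= n <= #|B|)%N ->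
  exists C : {set T}, [/\ A \subset C, C \subset B & #|C| = n].
Proof.
move=> AB /andP[An nB]; have [k] := ubnPleq (n - #|A|)%N.
elim: k A AB An => [|k IH] A AB An.
  rewrite leqn0 subn_eq0 => nA; exists A; split => //.
  by apply/eqP; rewrite eqn_leq An.
have [nA _|An' nk] := leqP n #|A|.
  by exists A; split => //; apply/eqP; rewrite eqn_leq An.
have /properP[_ [x xB xA]] : A \proper B.
  by rewrite properEcard AB (leq_trans An').
have cxA : #|x |: A| = #|A|.+1 by rewrite cardsU1 xA.
have xAB : x |: A \subset B by rewrite finset.subUset finset.sub1set xB AB.
have := IH _ xAB; rewrite cxA => /(_ An')[|C [xAC CB Cn]].
  by rewrite subnS; move: nk; case: (n - #|A|)%N.
by exists C; split => //; apply: fintype.subset_trans xAC; exact: finset.subsetUr.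
Qed.

(** * Lifts of grid points *)

(** The leading 1 sits at [ord0], where [unlift] returns [None]; it turns linear relations among
    lifts into affine relations among grid points. *)
Definition grid_vector (F : fieldType) k m (x : {ffun 'I_m -> 'I_k}) :
    'cV[F]_m.+1 :=
  \col_i oapp (fun l => (x l)%:R) 1 (unlift ord0 i).

Lemma sum_grid_vector (F : fieldType) k m (T : {set {ffun 'I_m -> 'I_k}})
    (u : {ffun 'I_m -> 'I_k} -> F) :
  (\sum_(x in T) u x *: grid_vector F x == 0) =
  (\sum_(x in T) u x == 0) && [forall l, \sum_(x in T) u x * (x l)%:R == 0].
Proof.
apply/eqP/andP => [/colP uT|[/eqP u0 /forallP ul]].
  split; [|apply/forallP => l]; apply/eqP.
    have := uT ord0; rewrite summxE mxE => u0; rewrite -[RHS]u0.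
    by apply: eq_bigr => x _; rewrite !mxE unlift_none mulr1.
  have := uT (lift ord0 l); rewrite summxE mxE => u0; rewrite -[RHS]u0.
  by apply: eq_bigr => x _; rewrite !mxE liftK.
apply/colP => i; rewrite summxE mxE; case: (unliftP ord0 i) => [l|] ->.
  by rewrite -[RHS](eqP (ul l)); apply: eq_bigr => x _; rewrite !mxE liftK.
by rewrite -[RHS]u0; apply: eq_bigr => x _; rewrite !mxE unlift_none mulr1.
Qed.

(** The leading coordinate makes the two coefficients of a relation opposite; a coordinate where [x]
    and [y] differ then makes them vanish. *)
Lemma rank_grid_pair (F : numFieldType) k m (x y : {ffun 'I_m -> 'I_k}) :
  x != y -> (1 < \rank (columns (@grid_vector F k m) [set x; y]))%N.
Proof.
move=> xy; rewrite rank_columns_full ?[ltnRHS]cards2 ?xy// => u /eqP.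
have sum2 (f : {ffun 'I_m -> 'I_k} -> F) :
    \sum_(z in [set x; y]%SET) f z = f x + f y.
  by rewrite big_setU1 ?inE// big_set1.
rewrite sum_grid_vector sum2 addr_eq0 => /andP[/eqP uxy /forallP ul].
have [l xyl] : exists l, x l != y l.
  apply/existsP; apply: contraNT xy => /existsPn xyl.
  by apply/eqP/ffunP => l; have /negPn/eqP := xyl l.
have uy : u y = 0.
  have := ul l; rewrite sum2 uxy mulNr addrC -mulrBr mulf_eq0 subr_eq0.
  by rewrite eqr_nat => /orP[/eqP//|/eqP/val_inj yxl]; rewrite yxl eqxx in xyl.
by move=> z; rewrite !inE => /orP[] /eqP->; rewrite ?uxy uy ?oppr0.
Qed.

Lemma card_le_rank_grid (F : numFieldType) k m
    (T : {set {ffun 'I_m -> 'I_k.+1}}) :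
  (#|T| <= k.+1 ^ \rank (columns (@grid_vector F _ m) T))%N.
Proof.
suff: (#|T| <= #|'I_k.+1| ^ \rank (columns (@grid_vector F _ m) T))%N.
  by rewrite card_ord.
(* The constant row must be coded in the same alphabet: there [phi] ignores its letter and [g]
   supplies the dummy [ord0]. *)
pose phi (i : 'I_m.+1) (a : 'I_k.+1) : F := oapp (fun=> a%:R) 1 (unlift ord0 i).
pose g (i : 'I_m.+1) (j : 'I_#|T|) : 'I_k.+1 :=
  oapp (enum_val j) ord0 (unlift ord0 i).
have AE : columns (@grid_vector F _ m) T = \matrix_(i, j) phi i (g i j).
  by apply/matrixP => i j; rewrite !mxE /phi /g; case: unlift.
rewrite AE; apply: (card_le_expn_rank (phi := phi) (g := g)); rewrite -AE => j1 j2.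
rewrite !col_columns => /colP e; apply: enum_val_inj; apply/ffunP => l.
have := e (lift ord0 l); rewrite !mxE liftK /= => /eqP.
by rewrite eqr_nat => /eqP/val_inj.
Qed.

(** Pigeonhole on two-element subsets: coordinates are at most k, so each coordinate of a sum takes
    at most 2k+1 values. *)
Lemma exists_pairs_same_sum k m (G : {set {ffun 'I_m -> 'I_k.+1}}) :
  (k.*2.+1 ^ m < 'C(#|G|, 2))%N ->
  exists A B : {set {ffun 'I_m -> 'I_k.+1}},
    [/\ A \subset G, B \subset G, #|A| = 2, #|B| = 2 & A != B /\
        forall l, (\sum_(x in A) x l = \sum_(x in B) x l)%N].
Proof.
move=> Gk; pose P := [set A : {set {ffun 'I_m -> 'I_k.+1}} |
  A \subset G & #|A| == 2]%SET.
pose s (A : {set {ffun 'I_m -> 'I_k.+1}}) : {ffun 'I_m -> 'I_k.*2.+1} :=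
  [ffun l => inord (\sum_(x in A) x l)%N].
have sE A l : A \in P -> s A l = (\sum_(x in A) x l)%N :> nat.
  rewrite inE => /andP[_ /eqP A2]; rewrite ffunE inordK// ltnS.
  rewrite -muln2 mulnC -[X in (_ <= X * _)%N]A2 -sum_nat_const.
  by apply: leq_sum => x _; rewrite -ltnS.
have : ~~ dinjectiveb s (mem P).
  apply: contraTN Gk => /dinjectiveP/leq_card_in.
  by rewrite card_ffun !card_ord cards_draws -leqNgt.
move=> /dinjectivePn[A AP [B /andP[BA BP] sAB]].
exists A, B; move: (AP) (BP); rewrite !inE.
move=> /andP[-> /eqP->] /andP[-> /eqP->]; do !split; first by rewrite eq_sym.
by move=> l; rewrite -!sE// sAB.
Qed.

(** * Lower bounds for the Hadwiger-Debrunner number *)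

Lemma le_HD (R : realType) d p q N (F : {fset set 'rV[R]_d}) :
  (forall A, A \in F -> nonempty_compact_convex A) -> pq_property p q F ->
  (forall X, Defs.transversal F X -> (N <= #|` X|)%N) ->
  (N%:R%:E <= HD R d p q)%E.
Proof.
move=> Fcc Fpq NF; apply/ereal_infP => _ [n + <-] => /(_ F Fcc Fpq).
apply: le_trans; apply/ereal_infP => _ [k [X FX <-] <-].
by rewrite lee_fin ler_nat NF.
Qed.

Lemma le_HD_of_grid (R : realType) d k m p N :
  (3 <= d < p)%N -> (p <= k.+1 ^ m)%N -> (k.*2.+1 ^ m < 'C(p, 2))%N ->
  (N * k.+1 ^ d <= k.+1 ^ m)%N ->
  (N%:R%:E <= HD R d p d.+1)%E.
Proof.
move=> /andP[d3 dp] pV pk NV; pose V := {ffun 'I_m -> 'I_k.+1}.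
have cardV : #|V| = (k.+1 ^ m)%N by rewrite card_ffun !card_ord.
have [||C [Cinj Ccc Cmeet Crank]] :=
    @exists_clipped_hyperplanes R d _ V (@grid_vector R _ m).
- exact: leq_trans d3.
- exact: rank_grid_pair.
pose F := [fset C x | x in {: V}]%fset.
have inF A : A \in F -> exists x, A = C x.
  by move=> /imfsetP[x _ ->]; exists x.
have cardF : #|` F| = #|V| by rewrite card_imfset//= -cardE.
apply: (@le_HD _ _ _ _ _ F).
- by move=> A /inF[x ->].
- split; first by rewrite cardF cardV.
  move=> G GF Gp; pose G' := [set x : V | C x \in G]%SET.
  have GE : G = [fset C x | x in G']%fset.
    apply/fsetP => A; apply/idP/imfsetP => [AG|[x /= + ->]]; last by rewrite inE.
    by have [x AE] := inF _ (fsubsetP GF _ AG); exists x; rewrite //= inE -AE.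
  have cardG' : #|G'| = p.
    by rewrite -Gp GE card_imfset//= -cardE; apply: eq_card => x; rewrite !inE.
  have [|A [B [AG BG A2 B2 [AB sAB]]]] := @exists_pairs_same_sum k m G'.
    by rewrite cardG'.
  (* The union has at most 4 elements, and 4 <= d+1 because [3 <= d]. *)
  have [||T [ABT TG Td]] := @exists_set_between V (A :|: B)%SET G' d.+1.
  + by rewrite finset.subUset AG BG.
  + rewrite cardG' dp andbT.
    by rewrite (leq_trans (leq_card_setU _ _))// A2 B2.
  have [AT BT] : A \subset T /\ B \subset T.
    by apply/andP; rewrite -finset.subUset.
  have rT : (\rank (columns (@grid_vector R _ m) T) <= d)%N.
    rewrite -ltnS -Td.
    (* The relation is the indicator of [A] minus that of [B]: equal sizes cancel the leading
       coordinate, equal sums the others. It is nonzero because [A] and [B] are distinct of the same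
       size. *)
    apply: (@rank_columns_lt _ _ _ _ _ (fun x => (x \in A)%:R - (x \in B)%:R)).
      apply/eqP; rewrite sum_grid_vector.
      have sumA (D : {set V}) (f : V -> nat) : D \subset T ->
          \sum_(x in T) (x \in D)%:R * (f x)%:R = (\sum_(x in D) f x)%:R :> R.
        move=> DT; rewrite natr_sum [LHS]big_mkcond [RHS]big_mkcond.
        apply: eq_bigr => x _; have [xD|_] := boolP (x \in D).
          by rewrite (fintype.subsetP DT)// mul1r.
        by rewrite mul0r if_same.
      have sum1 (D : {set V}) : D \subset T ->
          \sum_(x in T) (x \in D)%:R = #|D|%:R :> R.
        by move=> DT; rewrite -sum1_card -sumA//; apply: eq_bigr => x _; rewrite mulr1.
      rewrite sumrB !sum1// A2 B2 subrr eqxx /=; apply/forallP => l.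
      under eq_bigr do rewrite mulrBl.
      by rewrite sumrB !sumA// sAB subrr.
    have /subsetPn[x xA xB] : ~~ (A \subset B).
      apply: contra_neqN AB => AB; apply/eqP.
      by rewrite eqEcard AB A2 B2.
    exists x; first exact: (fintype.subsetP AT).
    by rewrite xA (negbTE xB) subr0 oner_eq0.
  have [y Cy] := Cmeet T rT.
  exists [fset C x | x in T]%fset; split.
  + rewrite GE; apply/fsubsetP => _ /imfsetP[x /= xT ->].
    by apply: in_imfset; exact: (fintype.subsetP TG).
  + by rewrite card_imfset//= -cardE.
  + by exists y => _ /imfsetP[x /= xT ->]; exact: Cy.
- move=> X FX; rewrite -(@leq_pmul2r (k.+1 ^ d)) ?expn_gt0//.
  apply: leq_trans NV _; rewrite -cardV.
  (* Double counting: [f] picks a piercing point for each grid point. The lifts in a fibre of [f]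
     have rank at most [d], so the fibre has at most (k+1)^d elements. *)
  have [f fP] : exists f : V -> X, forall x, C x (val (f x)).
    apply: (@fin_all_exists _ (fun=> X) (fun x y => C x (val y))) => x.
    have [|y yX Cxy] := FX (C x); first exact: in_imfset.
    by exists [` yX]%fset.
  rewrite -sum1_card (partition_big f predT)//=.
  rewrite cardfE -sum_nat_const; apply: leq_sum => y _.
  rewrite (eq_bigl (mem [set x | f x == y]%SET)) => [|x]; last by rewrite /= finset.in_set.
  rewrite sum1_card.
  apply: leq_trans (card_le_rank_grid R _) _; rewrite leq_pexp2l//.
  by apply: (Crank _ (val y)) => x; rewrite finset.in_set => /eqP <-.
Qed.

(* With k = 2^a and m = 2s, the value of p is 2 (2k)^(m/2). *)
Lemma le_HD_two_power (R : realType) d a s :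
  (3 <= d)%N -> (2 <= a)%N -> (d <= s.*2)%N ->
  ((2 ^ (a * (s.*2 - d)))%:R%:E <= HD R d (2 ^ (s * a.+1).+1) d.+1)%E.
Proof.
move=> d3 a2 ds; have s0 : (0 < s)%N by lia.
have s2 : (s * 2 <= s * a)%N by rewrite leq_mul2l a2 orbT.
have aE : (2 ^ a).-1.+1 = (2 ^ a)%N by rewrite prednK// expn_gt0.
have asE : (a * s.*2 = (s * a).*2)%N by rewrite -doubleMr mulnC.
apply: (@le_HD_of_grid R d (2 ^ a).-1 s.*2); rewrite ?aE -?expnM.
- rewrite d3 (leq_ltn_trans _ (ltn_expl _ _))// mulnS; lia.
- rewrite leq_exp2l// asE mulnS; lia.
- rewrite bin2 expnS -mulnA mul2n half_double.
  (* The binomial is q(2q-1) >= q^2, and q^2 = (2^(a+1))^(2s) has a base exceeding 2k+1 = 2^(a+1)-1,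
     where k = 2^a-1. *)
  set q := (2 ^ (s * a.+1))%N; have q0 : (0 < q)%N by rewrite expn_gt0.
  apply: (@leq_trans (q * q)%N); last by rewrite leq_pmul2l//; lia.
  have -> : (q * q = (2 ^ a.+1) ^ s.*2)%N.
    by rewrite -expnD addnn -expnM -doubleMr mulnC.
  by rewrite ltn_exp2r ?double_gt0// expnS; lia.
- by rewrite -expnD -mulnDr subnK.
Qed.

(** The hypothesis compares base-2 logarithms: s(a+1)+1 is that of p, and a(2s-d) that of the lower
    bound; [C] absorbs terms independent of [s]. *)
Lemma le_HD_powR (R : realType) d a s (x C : R) :
  (3 <= d)%N -> (2 <= a)%N -> (d <= s.*2)%N ->
  x * (s%:R * (a%:R + 1) + 1) <= a%:R * (2 * s%:R - d%:R) + C ->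
  ((2 `^ (- C) * (2 ^ (s * a.+1).+1)%:R `^ x)%:E <=
    HD R d (2 ^ (s * a.+1).+1) d.+1)%E.
Proof.
move=> d3 a2 ds xC; apply: le_trans (le_HD_two_power R d3 a2 ds).
rewrite lee_fin !natrX -!powR_mulrn// -powRrM -powRD ?pnatr_eq0 ?implybT//.
apply: ler_powR; first by rewrite ler1n.
rewrite natrM natrB// -muln2 natrM -natr1 natrM -natr1.
lra.
Qed.

Theorem theorem1p8 (R : realType) (d : nat) (hd : (3 <= d)%N) :
  (forall gamma : R, 0 < gamma ->
     exists2 c : R, 0 < c &
       forall m : nat, exists p : nat,
         [/\ (m <= p)%N, (d.+1 <= p)%N
           & ((c * p%:R `^ (2 - gamma))%:E <= HD R d p d.+1)%E]) /\
  (exists (p : nat -> nat) (e : nat -> R),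
     [/\ p k @[k --> \oo] --> \oo,
         e k @[k --> \oo] --> (0 : R),
         forall k : nat, (d.+1 <= p k)%N
       & forall k : nat,
           (((p k)%:R `^ (2 - e k))%:E <= HD R d (p k) d.+1)%E]).
Proof.
have p_gt n s a : (n <= s)%N -> (n < 2 ^ (s * a.+1).+1)%N.
  move=> ns; rewrite (leq_ltn_trans ns)// (leq_ltn_trans _ (ltn_expl _ _))//.
  by rewrite mulnS ltnW// ltnS leq_addr.
split.
(* With gamma * a >= 2, the saving gamma * s * a in the exponent pays for the excess 2s coming from
   a+1 in place of a. *)
- move=> gamma gamma0; pose a := (Num.truncn (2 / gamma)).+2.
  have a_gamma : 2 <= gamma * a%:R.
    rewrite mulrC -ler_pdivrMr// ltW// (lt_trans (truncnS_gt _))//.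
    by rewrite ltr_nat.
  (* [C] covers the remaining terms: a * d from the bound, and 2 from the extra factor 2 in p. *)
  pose C : R := 2 + a%:R * d%:R.
  exists (2 `^ (- C)) => [|m]; first by rewrite powR_gt0.
  pose s := (m + d)%N.
  exists (2 ^ (s * a.+1).+1)%N; split.
  + by rewrite ltnW// p_gt// leq_addr.
  + by rewrite p_gt// leq_addl.
  apply: le_HD_powR => //.
    by rewrite -addnn (leq_trans (leq_addl m d))// leq_addr.
  have s0 : 0 <= s%:R :> R by [].
  have : 2 * s%:R <= gamma * a%:R * s%:R by rewrite ler_wpM2r.
  have := mulr_ge0 (ltW gamma0) s0.
  rewrite /C; nra.
- pose a k := (k + d).+2.
  (* Here [s] and [a] are both x = [a k], and C = 0. The excess to absorb is (d+2)x + 2 <= (d+4)x,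
     and e x^2 >= (d+4)x for e = (d+4)/(k+1), since k+1 <= x. *)
  exists (fun k => 2 ^ (a k * (a k).+1).+1)%N.
  exists (fun k => (d + 4)%:R * harmonic k); split.
  + apply/cvgnyPge => A; near=> k; rewrite ltnW// p_gt//.
    rewrite /a (@leq_trans k)//; last by rewrite -addn2 -addnA leq_addr.
    by near: k; exact: nbhs_infty_ge.
  + by rewrite -[X in _ --> X](mulr0 (d + 4)%:R); apply: cvgMl_tmp; exact: cvg_harmonic.
  + by move=> k; rewrite p_gt// /a -addn2 -addnA addnCA leq_addr.
  move=> k; have := @le_HD_powR R d (a k) (a k) (2 - (d + 4)%:R * harmonic k) 0 hd.
  rewrite oppr0 powRr0 mul1r; apply=> //.
    by rewrite -addnn /a -addn2 -!addnA addnCA leq_addr.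
  have ak : k.+1%:R <= (a k)%:R :> R.
    by rewrite ler_nat /a ltnS leqW// leq_addr.
  have a1 : 1 <= (a k)%:R :> R by rewrite ler1n.
  set x := (a k)%:R in ak a1 *.
  have h0 : 0 <= (@harmonic R) k by rewrite /harmonic/= invr_ge0.
  have h1 : 1 <= harmonic k * x.
    by rewrite /harmonic/= mulrC ler_pdivlMr// mul1r.
  have h2 : x <= harmonic k * (x * x) by rewrite mulrA ler_peMl// (le_trans _ a1).
  have d0 : 0 <= (d + 4)%:R :> R by [].
  have := ler_wpM2l d0 h2.
  have : 0 <= (d + 4)%:R * (harmonic k * (x + 1)).
    by rewrite !mulr_ge0// addr_ge0// (le_trans _ a1).
  rewrite natrD; nra.
Unshelve. all: by end_near.
Qed.
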